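(* Let $(\mathfrak g,[\cdot,\cdot],\alpha)$ be a multiplicative Hom-Lie superalgebra over $\mathbb K$, let $n\ge 2$, and let $R$ be a Rota-Baxter operator of weight $0$ on $(\mathfrak g,[\cdot,\cdot],\alpha)$. Then $R$ is a Rota-Baxter operator of weight $0$ on the associated $n$-ary Hom-Nambu superalgebra $(\mathfrak g,[\cdot,\dots,\cdot]_n,\alpha^{n-1})$, where $[x_1,x_2]_2=[x_1,x_2]$ and $[x_1,\dots,x_m]_m=\big[[x_1,\dots,x_{m-1}]_{m-1},\alpha^{m-2}(x_m)\big]$ for $m\ge 3$.
   Context: $\mathbb K$ is an algebraically closed field of characteristic zero. $|v|\in\mathbb Z_2$ denotes the degree of a homogeneous element $v$; a map is even if it preserves total degree. $\alpha^k$ is the $k$-fold composition of $\alpha$. A Hom-Lie superalgebra $(\mathfrak g,[\cdot,\cdot],\alpha)$ is a $\mathbb Z_2$-graded linear space with an even bilinear map $[\cdot,\cdot]$ and an even linear map $\alpha:\mathfrak g\to\mathfrak g$ such that for homogeneous $x,y,z$: $[x,y]=-(-1)^{|x||y|}[y,x]$ and $(-1)^{|x||z|}[\alpha(x),[y,z]]+(-1)^{|y||x|}[\alpha(y),[z,x]]+(-1)^{|z||y|}[\alpha(z),[x,y]]=0$. It is multiplicative if $\alpha([x,y])=[\alpha(x),\alpha(y)]$. For a $\mathbb Z_2$-graded space $\mathcal N$ with an even $m$-linear bracket and an even linear map $\beta$, a Rota-Baxter operator of weight $0$ on $(\mathcal N,[\cdot,\dots,\cdot],\beta)$ is an even linear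 map $R:\mathcal N\to\mathcal N$ with $R\beta=\beta R$ and $$[R(x_1),\dots,R(x_m)]=R\Big(\sum_{i=1}^m[R(x_1),\dots,R(x_{i-1}),x_i,R(x_{i+1}),\dots,R(x_m)]\Big)\quad\text{for all }x_1,\dots,x_m\in\mathcal N.$$ *)

(* Defs.v *)
From HB Require Import structures.
From mathcomp Require Import all_boot all_algebra.

Set Implicit Arguments.
Unset Strict Implicit.
Unset Printing Implicit Defensive.

Import GRing.Theory.
Local Open Scope ring_scope.

(* The spaces may be infinite-dimensional, so the homogeneous components are
   Prop-valued subspaces.  The zero vector is homogeneous of both degrees. *)
Record superspace (K : fieldType) := Superspace {
  carrier :> lmodType K;
  homog : 'Z_2 -> carrier -> Prop;
  homog0 : forall d, homog d 0;
  homogP : forall d (a : K) u v,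
    homog d u -> homog d v -> homog d (a *: u + v);
  homog_sum : forall v, exists v0 v1,
    [/\ homog 0 v0, homog 1 v1 & v = v0 + v1];
  homog_direct : forall v, homog 0 v -> homog 1 v -> v = 0
}.

Definition even_map (K : fieldType) (V : superspace K) (f : V -> V) : Prop :=
  forall d v, homog d v -> homog d (f v).

(* Degrees in 'Z_2 are coerced to their representatives 0 and 1 in nat when
   they are used as exponents of -1. *)
Record homLieSuperalgebra (K : fieldType) (V : superspace K) :=
  HomLieSuperalgebra {
  br : {bilinear V -> V -> V};
  alpha : {linear V -> V};
  br_even : forall (a b : 'Z_2) (x y : V),
    homog a x -> homog b y -> homog (a + b) (br x y);
  alpha_even : even_map alpha;
  br_skew : forall (a b : 'Z_2) (x y : V), homog a x -> homog b y ->
    br x y = - ((-1) ^+ (a * b)%R *: br y x);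
  br_jacobi : forall (a b c : 'Z_2) (x y z : V),
    homog a x -> homog b y -> homog c z ->
    (-1) ^+ (a * c)%R *: br (alpha x) (br y z)
    + (-1) ^+ (b * a)%R *: br (alpha y) (br z x)
    + (-1) ^+ (c * b)%R *: br (alpha z) (br x y) = 0
}.

Definition multiplicative (K : fieldType) (V : superspace K)
    (L : homLieSuperalgebra V) : Prop :=
  forall x y, alpha L (br L x y) = br L (alpha L x) (alpha L y).

Definition replace (T : Type) (m : nat) (x : {ffun 'I_m -> T}) (i : 'I_m)
    (v : T) : {ffun 'I_m -> T} :=
  [ffun j => if j == i then v else x j].

Definition multilinear (K : fieldType) (V : lmodType K) (m : nat)
    (f : {ffun 'I_m -> V} -> V) : Prop :=
  forall (i : 'I_m) (x : {ffun 'I_m -> V}), linear (fun v => f (replace x i v)).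

Definition even_nary (K : fieldType) (V : superspace K) (m : nat)
    (f : {ffun 'I_m -> V} -> V) : Prop :=
  forall (d : 'I_m -> 'Z_2) (x : {ffun 'I_m -> V}),
    (forall i, homog (d i) (x i)) -> homog (\sum_i d i) (f x).

(* A Z_2-graded space with an even m-linear bracket and an even linear map;
   no Hom-Nambu identity is required. *)
Record naryHomSuperalgebra (K : fieldType) (V : superspace K) (m : nat) :=
  NaryHomSuperalgebra {
  nbr : {ffun 'I_m -> V} -> V;
  twist : {linear V -> V};
  nbr_multilinear : multilinear nbr;
  nbr_even : even_nary nbr;
  twist_even : even_map twist
}.

Record rota_baxter0 (K : fieldType) (V : superspace K) (m : nat)
    (A : naryHomSuperalgebra V m) (R : {linear V -> V}) : Prop :=
  RotaBaxter0 {
  rb_even : even_map R;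
  rb_comm : forall v, R (twist A v) = twist A (R v);
  rb_identity : forall x : {ffun 'I_m -> V},
    nbr A [ffun j => R (x j)]
    = R (\sum_(i < m) nbr A [ffun j => if j == i then x j else R (x j)])
}.

Section Associated.

Variables (K : fieldType) (V : superspace K) (L : homLieSuperalgebra V).

Definition br2 (x : {ffun 'I_2 -> V}) : V := br L (x ord0) (x ord_max).

(* The recursion is started at [x_1]_1 = x_1, from which [x_1, x_2]_2 =
   [x_1, x_2] since alpha^0 = id (see nbracket2).  The value for m = 0 is
   irrelevant. *)
Fixpoint nbracket (m : nat) : {ffun 'I_m -> V} -> V :=
  match m with
  | 0 => fun _ => 0
  | p.+1 => match p return ({ffun 'I_p -> V} -> V) -> {ffun 'I_p.+1 -> V} -> V
            with
    | 0 => fun _ x => x ord0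
    | q.+1 => fun rec x =>
        br L (rec [ffun i => x (widen_ord (leqnSn q.+1) i)])
             (iter q (alpha L) (x ord_max))
    end (@nbracket p)
  end.

Lemma nbracket2 (x : {ffun 'I_2 -> V}) :
  nbracket x = br L (x ord0) (x ord_max).
Proof. by rewrite /= ffunE; congr (br L (x _) _); apply: val_inj. Qed.

Lemma nbracketS (q : nat) (x : {ffun 'I_q.+2 -> V}) :
  nbracket x = br L (nbracket [ffun i => x (widen_ord (leqnSn q.+1) i)])
                    (iter q (alpha L) (x ord_max)).
Proof. by []. Qed.

Lemma iter_alpha_linear (k : nat) : linear (iter k (alpha L)).
Proof. by elim: k => // k IHk a u v; rewrite /= IHk linearP. Qed.

HB.instance Definition _ (k : nat) :=
  GRing.isLinear.Build K V V *:%R (iter k (alpha L)) (iter_alpha_linear k).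

Lemma iter_alpha_even (k : nat) : even_map (iter k (alpha L)).
Proof. by elim: k => //= k IHk d v hv; apply: alpha_even; apply: IHk. Qed.

Lemma nbracket_multilinear (m : nat) : multilinear (@nbracket m).
Proof.
elim: m => [[]|[|q] IHq] // i x a u v; first by rewrite /= !ffunE (ord1 i) eqxx.
rewrite !nbracketS !ffunE; case: (eqVneq ord_max i) => [<-|ne_i].
  have E w : [ffun j => replace x ord_max w (widen_ord (leqnSn q.+1) j)]
           = [ffun j => x (widen_ord (leqnSn q.+1) j)].
    by apply/ffunP=> j; rewrite !ffunE -val_eqE /= (ltn_eqF (ltn_ord j)).
  by rewrite !E linearP linearPr.
have lt_i : (i < q.+1)%N by rewrite ltn_neqAle -ltnS ltn_ord eq_sym -val_eqE in ne_i *; rewrite ne_i.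
have E w : [ffun j => replace x i w (widen_ord (leqnSn q.+1) j)]
         = replace [ffun j => x (widen_ord (leqnSn q.+1) j)] (Ordinal lt_i) w.
  by apply/ffunP=> j; rewrite !ffunE -!val_eqE.
by rewrite !E IHq linearPl.
Qed.

Lemma nbracket_even (m : nat) : even_nary (@nbracket m).
Proof.
elim: m => [|[|q] IHq] d x hx; first by rewrite big_ord0; apply: homog0.
  by rewrite big_ord1; apply: hx.
rewrite nbracketS big_ord_recr /=; apply: br_even.
  by apply: IHq => i; rewrite ffunE.
by apply: iter_alpha_even.
Qed.

Lemma br2_multilinear : multilinear br2.
Proof.
move=> i x a u v; have := nbracket_multilinear i x a u v.
by rewrite !nbracket2.
Qed.

Lemma br2_even : even_nary br2.
Proof. by move=> d x /nbracket_even; rewrite nbracket2. Qed.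

Definition binary_structure : naryHomSuperalgebra V 2 :=
  NaryHomSuperalgebra br2_multilinear br2_even (@alpha_even K V L).

Definition nary_structure (n : nat) : naryHomSuperalgebra V n :=
  @NaryHomSuperalgebra K V n (@nbracket n) (iter n.-1 (alpha L))
    (@nbracket_multilinear n) (@nbracket_even n) (@iter_alpha_even n.-1).

End Associated.

(* Main.v *)
Require Import Defs.
From mathcomp Require Import all_boot all_algebra.

(** The bracket is built from the left: with q + 2 arguments it is the binary
    bracket of the bracket of the first q + 1 arguments and the twisted last
    one.  If all arguments are images under [R], the induction hypothesis says
    that the inner bracket is [R S], where [S] sums the inner brackets in which
    one argument is freed from [R]; as [R] commutes with the twist, the outer
    entry is [R a], where [a] is the twisted last argument.  The binary identity
    [br (R S) (R a) = R (br S (R a) + br (R S) a)] then splits the outcome as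
    required: [br S (R a)] collects the terms in which one of the first q + 1
    arguments is free, and [br (R S) a] is, by the induction hypothesis read
    backwards, the term in which the last one is.  The induction starts at one
    argument, where both sides are [R x]. *)

Lemma iter_comm (T : Type) (h f : T -> T) (k : nat) :
  (forall v, h (f v) = f (h v)) -> forall v, h (iter k f v) = iter k f (h v).
Proof. by move=> hf v; elim: k => //= k <-. Qed.

Section RotaBaxter.

Import GRing.Theory.
Local Open Scope ring_scope.

Variables (K : fieldType) (g : superspace K) (L : homLieSuperalgebra g).
Variable R : {linear g -> g}.

Lemma rota_baxter0_binaryE (hR : rota_baxter0 (binary_structure L) R) u v :
  br L (R u) (R v) = R (br L u (R v) + br L (R u) v).
Proof.
have := rb_identity hR [ffun j : 'I_2 => if j == ord0 then u else v].
by rewrite big_ord_recl big_ord1 /= /br2 !ffunE.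
Qed.

(** Stated from one argument on, so that the recursion of [nbracket] itself
    serves as the induction step: the binary bracket is the case q = 0 of
    [br L (nbracket L _) (iter q (alpha L) _)]. *)
Lemma nbracket_rota_baxter (hR : rota_baxter0 (binary_structure L) R) (m : nat)
    (x : {ffun 'I_m.+1 -> g}) :
  nbracket L [ffun j => R (x j)]
  = R (\sum_(i < m.+1) nbracket L [ffun j => if j == i then x j else R (x j)]).
Proof.
elim: m x => [|q IHq] x; first by rewrite big_ord1 /= !ffunE.
set y : {ffun 'I_q.+1 -> g} := [ffun i => x (widen_ord (leqnSn q.+1) i)].
have restrictR : [ffun i => [ffun j => R (x j)] (widen_ord (leqnSn q.+1) i)]
    = [ffun j => R (y j)] by apply/ffunP => j; rewrite !ffunE.
have Ralpha v : R (iter q (alpha L) v) = iter q (alpha L) (R v).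
  by apply: iter_comm; exact: (rb_comm hR).
rewrite nbracketS restrictR ffunE -Ralpha IHq rota_baxter0_binaryE // -IHq.
congr (R _); rewrite [RHS]big_ord_recr; congr (_ + _); last first.
  rewrite nbracketS ffunE eqxx; congr (br L (nbracket L _) _); apply/ffunP => j.
  by rewrite !ffunE -val_eqE /= (ltn_eqF (ltn_ord j)).
rewrite linear_sumlz; apply: eq_bigr => i _.
have max_neq : (ord_max == widen_ord (leqnSn q.+1) i) = false.
  by rewrite -val_eqE /= (gtn_eqF (ltn_ord i)).
rewrite nbracketS ffunE max_neq -Ralpha.
by congr (br L (nbracket L _) _); apply/ffunP => j; rewrite !ffunE -val_eqE.
Qed.

End RotaBaxter.

Theorem proposition4p4 (K : closedFieldType) (charK : [pchar K]%R =i pred0)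
    (g : superspace K) (L : homLieSuperalgebra g) (multL : multiplicative L)
    (n : nat) (hn : (2 <= n)%N) (R : {linear g -> g}%R)
    (hR : rota_baxter0 (binary_structure L) R) :
  rota_baxter0 (nary_structure L n) R.
Proof.
case: n hn => // m _; split=> [|v|x].
- exact: (rb_even hR).
- by apply: iter_comm; exact: (rb_comm hR).
- exact: nbracket_rota_baxter.
Qed.
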